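(* Let $(X,d_X,\mu_X)$ be a metric measure space with $\mu_X(X)=1$, let $0<\varepsilon\le 1/2$ and $0<\kappa<1$. Assume that for some $\rho>0$ one has $1<\mathrm{Exp}_{\mathrm{Ledoux}}(X;1-\varepsilon,\rho)<\infty$ and $$2\left(1-\mathrm{Exp}_{\mathrm{Gromov}}(X;\varepsilon,\rho)\,\varepsilon\right)\mathrm{Exp}_{\mathrm{Ledoux}}(X;1-\varepsilon,\rho)\ \ge\ \kappa.$$ Then $$\mathrm{Exp}_{\mathrm{Gromov}}(X;\varepsilon,\rho)\ \le\ \frac{2-\kappa\,\exp\!\left(\frac{\left(\mathrm{ObsDiam}(X;-\kappa)-4\rho\right)\ln\mathrm{Exp}_{\mathrm{Ledoux}}(X;1-\varepsilon,\rho)}{2\rho}\right)}{2\varepsilon}.$$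
   Context: A metric measure space $(X,d_X,\mu_X)$ is a metric space $(X,d_X)$ with a finite Borel measure $\mu_X$; throughout $\mu_X(X)=1$. For $A\subset X$ and $r\ge 0$, $A_r=\{x\in X: d_X(x,A)\le r\}$. Gromov's expansion coefficient ($0<\varepsilon<1$, $\rho>0$): $\mathrm{Exp}_{\mathrm{Gromov}}(X;\varepsilon,\rho)$ is the supremum of all real $e\ge 1$ such that $\mu_X(A_\rho)\ge e\,\varepsilon$ for every Borel set $A\subset X$ with $\mu_X(A)\ge\varepsilon$. Ledoux's expansion coefficient ($0<\varepsilon<1$, $\rho>0$): $\mathrm{Exp}_{\mathrm{Ledoux}}(X;\varepsilon,\rho)$ is the supremum of all real $e\ge1$ such that $\mu_X(B_\rho)\ge e\,\mu_X(B)$ for every Borel set $B\subset X$ with $\mu_X(B_\rho)\le\varepsilon$. Observable diameter: for a Borel probability measure $\nu$ on $\mathbb{R}$ and $\kappa>0$, $\mathrm{PartDiam}_\nu(\mathbb{R};1-\kappa)$ is the infimum of all $D$ such that there is a (Borel) subset $A\subset\mathbb{R}$ with $\mathrm{diam}(A)\le D$ and $\nu(A)\ge 1-\kappa$. Then $\mathrm{ObsDiam}(X;-\kappa)$ is the supremum of $\mathrm{PartDiam}_{f_*\mu_X}(\mathbb{R};1-\kappa)$ over all $1$-Lipschitz functions $f:X\to\mathbb{R}$ (i.e. $|f(x)-f(y)|\le d_X(x,y)$), where $f_*\mu_X$ is the push-forward measure. *)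

(* Defs.v *)
From HB Require Import structures.
From mathcomp Require Import all_boot all_order all_algebra.
From mathcomp Require Import all_classical all_reals all_analysis.

Set Implicit Arguments.
Unset Strict Implicit.
Unset Printing Implicit Defensive.

Import Order.TTheory GRing.Theory Num.Theory.
Import numFieldNormedType.Exports.

Local Open Scope classical_set_scope.
Local Open Scope ring_scope.

(* MathComp-Analysis builds sigma-algebras on pointed types only; the point is
   harmless since a space of total measure 1 is nonempty. *)
#[short(type="pointedMetricType")]
HB.structure Definition PointedMetric (R : numDomainType) :=
  { X of Metric R X & isPointed X }.

(* X with its Borel sigma-algebra, so that a probability measure
   [mu : probability (borel X) R] makes X a metric measure space with
   mu(X) = 1 *)
Notation borel X := (g_sigma_algebraType (@open X)).

Section MetricMeasureSpace.
Context {R : realType} {X : pointedMetricType R}.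
Implicit Types (A B : set X) (mu : probability (borel X) R).

(* +oo when A is empty *)
Definition dist_to_set (x : X) A : \bar R :=
  ereal_inf [set (mdist x y)%:E | y in A].

Definition thickening A (r : R) : set X :=
  [set x | (dist_to_set x A <= r%:E)%E].

Definition exp_gromov mu (eps rho : R) : \bar R :=
  ereal_sup [set e%:E | e in [set e : R | 1 <= e /\
    forall A, measurable (A : set (borel X)) ->
      (eps%:E <= mu A)%E -> ((e * eps)%:E <= mu (thickening A rho))%E]].

Definition exp_ledoux mu (eps rho : R) : \bar R :=
  ereal_sup [set e%:E | e in [set e : R | 1 <= e /\
    forall B, measurable (B : set (borel X)) ->
      (mu (thickening B rho) <= eps%:E)%E ->
      (e%:E * mu B <= mu (thickening B rho))%E]].

Definition diam (A : set R) : \bar R :=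
  ereal_sup [set `|x - y|%:E | x in A & y in A].

(* [measurableTypeR R] is R with its Borel sigma-algebra *)
Definition part_diam (nu : set (measurableTypeR R) -> \bar R) (m : R) : \bar R :=
  ereal_inf [set D%:E | D in [set D : R |
    exists A : set (measurableTypeR R),
      [/\ measurable A, (diam A <= D%:E)%E & (m%:E <= nu A)%E]]].

Definition lipschitz1 (f : X -> R) : Prop :=
  forall x y, `|f x - f y| <= mdist x y.

(* [obs_diam mu kappa] is ObsDiam(X; -kappa) *)
Definition obs_diam mu (kappa : R) : \bar R :=
  ereal_sup [set part_diam
      (pushforward mu (f : borel X -> measurableTypeR R)) (1 - kappa)
    | f in [set f : X -> R | lipschitz1 f]].

End MetricMeasureSpace.

(* Main.v *)
Require Import Defs.
From HB Require Import structures.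
From mathcomp Require Import all_boot all_order all_algebra.
From mathcomp Require Import all_classical all_reals all_analysis.
From mathcomp Require Import measurable_realfun lra ring.

(** Write [g] and [l] for the Gromov and Ledoux coefficients at radius [rho],
    and [eta = 1 - g eps].  The theorem solves for [g] an upper bound on the
    observable diameter, namely

      ObsDiam(X; -kappa) <= 4 rho + 2 rho ln (2 eta / kappa) / ln l.

    To bound it, take a 1-Lipschitz [f] with median [m].  As [eps <= 1/2], the
    set [{f <= m}] has measure at least [eps], so Gromov expansion gives it a
    [rho]-neighbourhood of measure at least [g eps]; since [f <= m + rho] there,
    the tail [{f > m + rho}] has measure at most [eta].  Superlevel sets of [f]
    further up satisfy the hypothesis of Ledoux expansion, because their
    [rho]-neighbourhoods still avoid [{f <= m}], and the [rho]-neighbourhood of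
    [{f >= t + rho}] lies in [{f >= t}].  Each further step of length [rho]
    therefore divides the tail by [l] (lemma [tail_decay]), and the same holds
    for [- f].  Once [2 eta <= kappa l ^ j] the two tails at distance
    [(j + 1) rho] from the median have total measure at most [kappa], whence
    ObsDiam(X; -kappa) <= 2 (j + 1) rho (lemma [obs_diam_le]).

    Finally let [j] be the integer part of [1 + ln (2 eta / kappa) / ln l],
    which is nonnegative exactly because [2 eta l >= kappa]: it is large enough
    for [obs_diam_le], and [j <= 1 + ln (2 eta / kappa) / ln l] gives the
    displayed bound.

    The tail estimate starts strictly above [m + rho], and only approximate
    medians are used; both cost an arbitrarily small increase of the
    diameter, absorbed by the infimum that defines the partial diameter. *)

Set Implicit Arguments.
Unset Strict Implicit.
Unset Printing Implicit Defensive.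

Import Order.TTheory GRing.Theory Num.Theory.
Import numFieldNormedType.Exports.

Local Open Scope classical_set_scope.
Local Open Scope ring_scope.

(** * Thickenings and Lipschitz functions *)

Section MetricGeometry.
Context {R : realType} {X : pointedMetricType R}.
Implicit Types (A : set X) (f : X -> R).

Lemma open_measurable_borel A : open A -> measurable (A : set (borel X)).
Proof. by move=> oA; apply: sub_sigma_algebra. Qed.

(** The infimum defining the distance need not be attained, hence the slack
    [e]. *)
Lemma thickening_point A (r e : R) (x : X) :
  0 < e -> thickening A r x -> exists2 a, A a & mdist x a < r + e.
Proof.
move=> e0 Arx.
have /ereal_inf_lt[_ [a Aa <-]] : (dist_to_set x A < (r + e)%:E)%E.
  by apply: le_lt_trans Arx _; rewrite lte_fin ltrDl.
by rewrite lte_fin; exists a.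
Qed.

(** A point at distance more than [r] from [A] is at distance at least some
    [s > r] (finite even when [A] is empty), so its ball of radius [s - r]
    avoids the thickening. *)
Lemma open_setC_thickening A (r : R) : open (~` thickening A r).
Proof.
rewrite openE => x /= /negP; rewrite -ltNge => rx.
have [s rs sx] : exists2 s : R, r < s & (s%:E <= dist_to_set x A)%E.
  case: (dist_to_set x A) rx => [t|_|//].
    by rewrite lte_fin => rt; exists t.
  by exists (r + 1); rewrite ?ltrDl// leey.
apply/nbhs_ballP; exists (s - r) => /=; first by rewrite subr_gt0.
move=> y; rewrite ballEmdist /= => xy yA.
have [|a Aa ya] := thickening_point (e := s - r - mdist x y) _ yA; first lra.
have : s <= mdist x a.
  by rewrite -lee_fin (le_trans sx)//; apply: ereal_inf_lbound; exists a.
apply/negP; rewrite -ltNge (le_lt_trans (metric_triangle x y a))//.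
lra.
Qed.

Lemma measurable_thickening A (r : R) :
  measurable (thickening A r : set (borel X)).
Proof.
rewrite -[thickening A r]setCK; apply: measurableC.
by apply: open_measurable_borel; exact: open_setC_thickening.
Qed.

Lemma lipschitz1_opp f : lipschitz1 f -> lipschitz1 (\- f).
Proof. by move=> f1 x y; rewrite /= -opprD normrN. Qed.

Lemma lipschitz1_measurable f : lipschitz1 f ->
  measurable_fun setT (f : borel X -> measurableTypeR R).
Proof.
move=> f1; apply: (measurability _ (RGenOpens.measurableE R)).
move=> _ [_ [a [b ->] <-]]; rewrite setTI; apply: open_measurable_borel.
have cf : continuous f.
  move=> x; apply/cvgrPdist_lt => e e0; apply/nbhs_ballP; exists e => //= y.
  by rewrite ballEmdist /= => xy; apply: le_lt_trans xy.
by move/continuousP: cf; apply; exact: interval_open.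
Qed.

(** Going up by [r] along a 1-Lipschitz function costs a distance at least [r];
    with closed superlevel sets the slack in the distance disappears in the
    limit. *)
Lemma thickening_superlevel f (t r : R) : lipschitz1 f ->
  thickening [set x | t + r <= f x] r `<=` [set x | t <= f x].
Proof.
move=> f1 x tx /=; apply/ler_addgt0Pr => e e0.
have [a /= ta xa] := thickening_point e0 tx.
have := f1 x a; rewrite ler_distlC => /andP[_]; lra.
Qed.

End MetricGeometry.

(** * Approximate medians *)

Section Levels.
Context d (T : measurableType d) (R : realType).
Implicit Types (f : T -> measurableTypeR R) (t : R).

Lemma measurable_sublevel f t :
  measurable_fun setT f -> measurable [set x | (f x <= t)%R].
Proof.
move=> mf; have := mf measurableT _ (measurable_itv `]-oo, t]).
by rewrite setTI; congr measurable; apply/seteqP; split => x /=; rewrite in_itv.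
Qed.

Lemma measurable_superlevel f t :
  measurable_fun setT f -> measurable [set x | (t <= f x)%R].
Proof.
move=> mf; have := mf measurableT _ (measurable_itv `[t, +oo[).
rewrite setTI; congr measurable.
by apply/seteqP; split => x /=; rewrite in_itv/= andbT.
Qed.

End Levels.

(** With [S] the set of [t] such that [{f <= t}] has measure at least [1/2], any
    [m] in [S] with [m < inf S + e] works, since [m - e] is not in [S].  That
    [S] is nonempty and bounded below is the tightness of the law of [f]. *)
Lemma near_median d (T : measurableType d) (R : realType)
    (P : probability T R) (f : T -> measurableTypeR R) (e : R) :
  measurable_fun setT f -> 0 < e ->
  exists m : R, ((1 / 2)%:E <= P [set x | (f x <= m)%R])%E /\
    ((1 / 2)%:E <= P [set x | (m - e <= f x)%R])%E.
Proof.
move=> mf e0.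
have tight (g : T -> measurableTypeR R) : measurable_fun setT g ->
    exists t, ((1 / 2)%:E < P [set x | (g x <= t)%R])%E.
  move=> mg; apply: contrapT => /forallNP small.
  have cupT : \bigcup_n [set x | (g x <= n%:R)%R] = setT.
    rewrite -subTset => x _; exists (Num.trunc (g x)).+1 => //=.
    by rewrite ltW// truncnS_gt.
  have : (P \o (fun n : nat => [set x | (g x <= n%:R)%R])) n @[n --> \oo] -->
      P (\bigcup_n [set x | (g x <= n%:R)%R]).
    apply: nondecreasing_cvg_mu => [n||n k nk].
    - exact: measurable_sublevel.
    - by rewrite cupT.
    - by apply/subsetPset => x /= /le_trans; apply; rewrite ler_nat.
  rewrite cupT probability_setT => Pcvg.
  have : (lim ((P \o (fun n : nat => [set x | (g x <= n%:R)%R])) n @[n --> \oo])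
      <= (1 / 2)%:E)%E.
    apply: lime_le; first by apply/cvg_ex; exists 1%E.
    by apply: nearW => n; rewrite leNgt; apply/negP; exact: small.
  by rewrite (cvg_lim _ Pcvg)// lee_fin; lra.
pose S := [set t | ((1 / 2)%:E <= P [set x | (f x <= t)%R])%E].
have compl t : (P [set x | (f x <= t)%R] < (1 / 2)%:E)%E ->
    ((1 / 2)%:E <= P [set x | (t <= f x)%R])%E.
  move=> Pt; have -> : (1 / 2)%:E = (1 - (1 / 2)%:E)%E :> \bar R.
    by rewrite -EFinB; congr EFin; lra.
  apply: (@le_trans _ _ (P (~` [set x | (f x <= t)%R]))).
    rewrite probability_setC; last exact: measurable_sublevel.
    by apply: leeB => //; exact: ltW.
  apply: le_measure; rewrite ?inE.
  - by apply: measurableC; exact: measurable_sublevel.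
  - exact: measurable_superlevel.
  - by move=> x /= /negP; rewrite -ltNge => /ltW.
have hinfS : has_inf S.
  split; first by have [t /ltW St] := tight f mf; exists t.
  (* A lower bound of S: {f >= - t} has measure > 1/2, and it is disjoint from
     {f <= s} when s < - t. *)
  have [t Pt] := tight (\- f) (measurable_funN mf).
  exists (- t) => s Ss; rewrite leNgt; apply/negP => st.
  have : ((1 / 2)%:E < 1 - (1 / 2)%:E :> \bar R)%E.
    apply: (lt_le_trans Pt).
    apply: (@le_trans _ _ (P (~` [set x | (f x <= s)%R]))).
      apply: le_measure; rewrite ?inE.
      - by apply: measurable_sublevel; exact: measurable_funN.
      - by apply: measurableC; exact: measurable_sublevel.
      - by move=> x /= fx; apply/negP; rewrite -ltNge; lra.
    rewrite probability_setC; last exact: measurable_sublevel.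
    by apply: leeB.
  by rewrite -EFinB lte_fin; lra.
have [m Sm mS] := inf_adherent e0 hinfS.
exists m; split => //; apply: compl; rewrite ltNge; apply/negP => Sme.
have := ge_inf hinfS.2 Sme; lra.
Qed.

(** * Expansion and concentration of Lipschitz functions *)

Section ExpansionCoefficients.
Context {R : realType} {X : pointedMetricType R}.
Variable mu : probability (borel X) R.
Implicit Types (A B : set X) (f : X -> R).

(** Every instance of the defining inequality is a closed condition on the
    factor, so it passes to the supremum. *)
Lemma exp_gromov_le (eps rho : R) A : 0 < eps ->
  measurable (A : set (borel X)) -> (eps%:E <= mu A)%E ->
  (exp_gromov mu eps rho * eps%:E <= mu (thickening A rho))%E.
Proof.
move=> eps0 mA epsA; rewrite -lee_pdivlMr//.
apply: ge_ereal_sup => _ [e [_ he] <-].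
by rewrite lee_pdivlMr// -EFinM; exact: he.
Qed.

Lemma exp_ledoux_le (eps rho : R) B :
  measurable (B : set (borel X)) -> (mu (thickening B rho) <= eps%:E)%E ->
  (exp_ledoux mu eps rho * mu B <= mu (thickening B rho))%E.
Proof.
move=> mB Beps.
have [->|B0] := eqVneq (mu B) 0%E; first by rewrite mule0.
have muB : (fine (mu B))%:E = mu B by rewrite fineK// fin_num_measure.
have b0 : 0 < fine (mu B) by rewrite -lte_fin muB lt0e B0/=.
rewrite -muB -lee_pdivlMr//.
apply: ge_ereal_sup => _ [e [_ he] <-].
by rewrite lee_pdivlMr// muB; exact: he.
Qed.

(** Gromov expansion of [{f <= m}] bounds the tail beyond [m + rho]; then each
    step of length [rho] gains a factor [l] by Ledoux expansion of the
    superlevel set.  The strict [m + rho < t] makes the closed superlevel set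
    [{f >= t}] disjoint from the closed thickening of [{f <= m}]. *)
Lemma tail_decay (eps rho g l : R) f (m t : R) (j : nat) :
  0 < eps -> 0 < rho -> 0 < l ->
  exp_gromov mu eps rho = g%:E -> exp_ledoux mu (1 - eps) rho = l%:E ->
  lipschitz1 f -> (eps%:E <= mu [set x | (f x <= m)%R])%E -> m + rho < t ->
  (mu [set x | (t + j%:R * rho <= f x)%R] <= ((1 - g * eps) / l ^+ j)%:E)%E.
Proof.
move=> eps0 rho0 l0 Eg El f1 medm mt.
have mge s : measurable ([set x | s <= f x] : set (borel X)).
  by apply: measurable_superlevel; exact: lipschitz1_measurable.
have leE : [set x | f x <= m] = [set x | - m <= (\- f) x].
  by apply/seteqP; split => x /=; rewrite lerN2.
have mle : measurable ([set x | f x <= m] : set (borel X)).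
  by apply: measurable_sublevel; exact: lipschitz1_measurable.
elim: j => [|j IH].
  rewrite mul0r addr0 expr0 divr1.
  apply: (@le_trans _ _ (mu (~` thickening [set x | f x <= m] rho))).
    apply: le_measure; rewrite ?inE; first exact: mge.
      by apply: measurableC; exact: measurable_thickening.
    move=> x /= tx xm.
    have := @thickening_superlevel _ _ (\- f) (- m - rho) rho (lipschitz1_opp f1).
    rewrite subrK -leE => /(_ _ xm) /=; lra.
  rewrite probability_setC; last exact: measurable_thickening.
  rewrite EFinB EFinM; apply: leeB => //.
  by rewrite -Eg; exact: exp_gromov_le.
set B := [set x | _]; set C := [set x | _] in IH.
have BC : (mu (thickening B rho) <= mu C)%E.
  apply: le_measure; rewrite ?inE; first exact: measurable_thickening.
    exact: mge.
  by rewrite /B -natr1 mulrDl mul1r addrA; exact: thickening_superlevel.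
(* C avoids {f <= m}, since its level is at least t > m. *)
have Ceps : (mu C <= (1 - eps)%:E)%E.
  apply: (@le_trans _ _ (mu (~` [set x | f x <= m]))).
    apply: le_measure; rewrite ?inE; [exact: mge|exact: measurableC|].
    move=> x /= Cx; apply/negP; rewrite -ltNge.
    have : 0 <= j%:R * rho by rewrite mulr_ge0// ltW.
    move: Cx; rewrite /C/=; lra.
  by rewrite probability_setC// EFinB; exact: leeB.
have := exp_ledoux_le (mge _) (le_trans BC Ceps).
rewrite El => /le_trans/(_ BC)/le_trans/(_ IH).
by rewrite -lee_pdivlMl// -EFinM => /le_trans; apply;
  rewrite lee_fin exprS invfM mulrCA.
Qed.

(** Cut the two tails of [f] at distance about [(j + 1) rho] from a median: what
    is left has measure at least [1 - kappa] and maps into an interval of length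
    about [2 (j + 1) rho]. *)
Lemma obs_diam_le (eps kappa rho g l : R) (j : nat) :
  0 < eps -> eps <= 1 / 2 -> 0 < rho -> 0 < l ->
  exp_gromov mu eps rho = g%:E -> exp_ledoux mu (1 - eps) rho = l%:E ->
  2 * (1 - g * eps) <= kappa * l ^+ j ->
  (obs_diam mu kappa <= (2 * j.+1%:R * rho)%:E)%E.
Proof.
move=> eps0 eps2 rho0 l0 Eg El jlarge.
apply: ge_ereal_sup => _ [f /= f1 <-]; apply/lee_addgt0Pr => e e0.
(* The two tails start at m + d and (m - d) - d, so that the interval exceeds
   the length 2 (j + 1) rho by 3 d. *)
have [d ed d0] : exists2 d, e = 3 * d & 0 < d.
  by exists (e / 3); [rewrite mulrC divfK|rewrite divr_gt0].
have [m [mle mge]] := near_median mu (lipschitz1_measurable f1) d0.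
have epsle (A : set X) : ((1 / 2)%:E <= mu A)%E -> (eps%:E <= mu A)%E.
  by apply: le_trans; rewrite lee_fin.
set s := m + d + j.+1%:R * rho.
set r := m - 2 * d - j.+1%:R * rho.
have up : (mu [set x | (s <= f x)%R] <= ((1 - g * eps) / l ^+ j)%:E)%E.
  have -> : s = (m + d + rho) + j%:R * rho by rewrite /s -natr1; ring.
  by apply: (tail_decay j eps0 rho0 l0 Eg El f1 (epsle _ mle)); lra.
have down : (mu [set x | (f x <= r)%R] <= ((1 - g * eps) / l ^+ j)%:E)%E.
  have -> : [set x | (f x <= r)%R] =
      [set x | (- (m - d) + d + rho) + j%:R * rho <= (\- f) x].
    by apply/seteqP; split => x /=; rewrite /r -natr1; lra.
  have eqm : [set x | (m - d <= f x)%R] = [set x | ((\- f) x <= - (m - d))%R].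
    by apply/seteqP; split => x /=; rewrite lerN2.
  rewrite eqm in mge.
  by apply: (tail_decay j eps0 rho0 l0 Eg El (lipschitz1_opp f1)
    (epsle _ mge)); lra.
apply: ereal_inf_lbound; exists (2 * j.+1%:R * rho + e); last by rewrite EFinD.
exists `]r, s[%classic; split; first exact: measurable_itv.
  apply: ge_ereal_sup => _ [x xI [y yI <-]].
  have /andP[rx xs] : r < x < s by move: (xI : x \in `]r, s[); rewrite in_itv.
  have /andP[ry ys] : r < y < s by move: (yI : y \in `]r, s[); rewrite in_itv.
  rewrite lee_fin ler_norml.
  by apply/andP; move: rx xs ry ys; rewrite /r /s; split; lra.
have mf := lipschitz1_measurable f1.
have mI : measurable (f @^-1` `]r, s[%classic : set (borel X)).
  by have := mf measurableT _ (measurable_itv `]r, s[); rewrite setTI.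
rewrite /pushforward -[X in mu X]setCK probability_setC; last exact: measurableC.
rewrite EFinB; apply: leeB => //.
apply: (@le_trans _ _ (mu ([set x | (f x <= r)%R] `|` [set x | (s <= f x)%R]))).
  apply: le_measure; rewrite ?inE; first exact: measurableC.
    by apply: measurableU;
      [exact: measurable_sublevel|exact: measurable_superlevel].
  move=> x /= /negP; rewrite in_itv/= negb_and -!leNgt => /orP[]; by [left|right].
apply: (le_trans (measureU2 _ _ _));
  [exact: measurable_sublevel|exact: measurable_superlevel|].
apply: (le_trans (leeD down up)).
by rewrite -EFinD lee_fin -mulrDl ler_pdivrMr ?exprn_gt0//; lra.
Qed.

End ExpansionCoefficients.

(** * The upper bound on the Gromov coefficient *)

Theorem corollary6p4 (R : realType) (X : pointedMetricType R)
    (mu : probability (borel X) R) (eps kappa rho : R)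
    (eps_gt0 : 0 < eps) (eps_le : eps <= 1 / 2)
    (kappa_gt0 : 0 < kappa) (kappa_lt1 : kappa < 1) (rho_gt0 : 0 < rho)
    (ledoux_gt1 : (1 < exp_ledoux mu (1 - eps) rho)%E)
    (ledoux_lty : (exp_ledoux mu (1 - eps) rho < +oo)%E)
    (hkappa : (2%:E * (1 - exp_gromov mu eps rho * eps%:E)
               * exp_ledoux mu (1 - eps) rho >= kappa%:E)%E) :
  (exp_gromov mu eps rho <=
    (2%:E - kappa%:E *
       expeR ((obs_diam mu kappa - (4 * rho)%:E)
              * lne (exp_ledoux mu (1 - eps) rho) / (2 * rho)%:E))
    / (2 * eps)%:E)%E.
Proof.
(* Testing the Gromov coefficient on the whole space shows that it is not
   +oo. *)
have gromov_le1 : (exp_gromov mu eps rho * eps%:E <= 1)%E.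
  apply: (@le_trans _ _ (mu (thickening setT rho))).
    by apply: exp_gromov_le => //; rewrite probability_setT lee_fin; lra.
  by apply: probability_le1; exact: measurable_thickening.
move El: (exp_ledoux mu (1 - eps) rho) ledoux_gt1 ledoux_lty hkappa => L.
case: L El => // l El; rewrite lte_fin => l1 _.
move Eg: (exp_gromov mu eps rho) gromov_le1 => G.
case: G Eg => [g Eg _||]; last 2 first.
- by rewrite mulyr gtr0_sg// mul1e.
- by rewrite leNye.
rewrite -[X in (kappa%:E <= X)%E]/((2 * (1 - g * eps) * l)%:E) lee_fin => hk.
have l0 : 0 < l by exact: lt_trans l1.
have eta0 : 0 < 1 - g * eps.
  rewrite ltNge; apply/negP => eta0.
  have : 2 * (1 - g * eps) * l <= 0.
    by rewrite mulr_le0_ge0 ?(ltW l0)// mulr_ge0_le0.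
  by move/(le_trans hk); lra.
set eta := 1 - g * eps in hk eta0 *.
have lnl0 : 0 < ln l by rewrite ln_gt0.
set z := 2 * eta / kappa.
have z0 : 0 < z by rewrite divr_gt0// mulr_gt0.
pose y := ln z / ln l.
(* [y + 1 = ln (z l) / ln l], and the hypothesis on kappa says [1 <= z l]. *)
have y1 : 0 <= y + 1.
  rewrite -[X in _ + X](divff (lt0r_neq0 lnl0)) -mulrDl divr_ge0 ?(ltW lnl0)//.
  rewrite -lnM ?posrE// ln_ge0// /z mulrAC ler_pdivlMr// mul1r//.
have /andP[jy yj] := truncn_itv y1.
set j := Num.trunc _ in jy yj.
have zj : z <= l ^+ j.
  rewrite -ler_ln ?posrE ?exprn_gt0// lnXn// -[_ *+ _]mulr_natl -ler_pdivrMr//.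
  by move: yj; rewrite -natr1 ltrD2r => /ltW.
have obs : (obs_diam mu kappa <= (2 * j.+1%:R * rho)%:E)%E.
  apply: (obs_diam_le eps_gt0 eps_le rho_gt0 l0 Eg El).
  by rewrite -/eta [kappa * _]mulrC -ler_pdivrMr.
rewrite lne_EFin// !inver !mulf_eq0 !pnatr_eq0/= !gt_eqF//.
rewrite lee_pdivlMr ?mulr_gt0//.
(* The observable diameter may be -oo as far as the extended-real operations
   are concerned: monotonicity treats that value like the others. *)
have expz : (expeR ((obs_diam mu kappa - (4 * rho)%:E) * (ln l)%:E *
    (2 * rho)^-1%:E) <= z%:E)%E.
  have <- : expeR (ln z)%:E = z%:E by rewrite /= lnK.
  rewrite lee_expeR lee_pdivrMr ?mulr_gt0//.
  apply: (@le_trans _ _ ((2 * j.+1%:R * rho - 4 * rho)%:E * (ln l)%:E)%E).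
    apply: lee_wpmul2r; first by rewrite lee_fin ltW.
    by rewrite EFinB; exact: leeB.
  rewrite -!EFinM lee_fin -ler_pdivlMr// [leRHS]mulrAC -/y.
  have -> : 2 * j.+1%:R * rho - 4 * rho = (j%:R - 1) * (2 * rho).
    by rewrite -natr1; ring.
  by rewrite ler_pM2r ?mulr_gt0// lerBlDr.
have kz : kappa * z = 2 * eta by rewrite /z mulrC divfK// gt_eqF.
apply: (@le_trans _ _ (2%:E - kappa%:E * z%:E)%E).
  rewrite -[leLHS]/((g * (2 * eps))%:E) -[leRHS]/((2 - kappa * z)%:E) kz lee_fin.
  by rewrite le_eqVlt; apply/orP; left; apply/eqP; rewrite /eta; ring.
apply: leeB; first exact: lexx.
by apply: lee_wpmul2l; [rewrite lee_fin ltW|exact: expz].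
Qed.
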